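(* Let $\mathcal{X}$ be an $n$-dimensional polyhedral Banach space with $\mathrm{ext}\,B_{\mathcal{X}}=\{\pm v_i: 1\leq i\leq m\}$. For each $i\in\{1,\ldots,m\}$, let $F_{i1},F_{i2},\ldots,F_{in}$ be any $n$ facets of $B_{\mathcal{X}}$ meeting at $v_i$, and let $f_{i1},f_{i2},\ldots,f_{in}$ be the $n$ supporting functionals corresponding to the facets $F_{i1},F_{i2},\ldots,F_{in}$, respectively. For each $i=1,2,\ldots,m$, let $$\xi_i=\min_{x\in S_{\mathcal{X}}}\left\{\max_{1\leq r\leq n}\sqrt{|f_{ir}(x)|^2+1}\right\}.$$ Then $$\eta_{dw}(\mathcal{X})\geq\min\{\xi_1,\xi_2,\ldots,\xi_m\}.$$
   Context: A finite-dimensional real Banach space $\mathcal{X}$ is polyhedral if its closed unit ball $B_{\mathcal{X}}$ has finitely many extreme points; $\mathrm{ext}\,B_{\mathcal{X}}$ is the set of extreme points; $S_{\mathcal{X}}=\{x:\|x\|=1\}$; $\mathcal{X}^*$ is the dual. A facet of $B_{\mathcal{X}}$ is a face of dimension $n-1$. A functional $f\in S_{\mathcal{X}^*}$ is a supporting functional corresponding to the facet $F$ of $B_{\mathcal{X}}$ if (i) $f$ attains its norm at some point $v$ of $F$, and (ii) $F=(v+\ker f)\cap S_{\mathcal{X}}$. $\mathcal{L}(\mathcal{X})$ is the space of bounded linear operators on $\mathcal{X}$ with the operator norm, and $S_{\mathcal{L}(\mathcal{X})}$ is its unit sphere. For $x\in S_{\mathcal{X}}$ put $\mathcal{J}(x)=\{f\in\mathcal{X}^*: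 f(x)=1=\|f\|\}$, and $\Pi=\{(x,f): x\in S_{\mathcal{X}}, f\in\mathcal{J}(x)\}$. The Davis-Wielandt radius of $T$ is $dw(T)=\sup\left\{\sqrt{|x^*(Tx)|^2+\|Tx\|^4}:(x,x^* )\in\Pi\right\}$ and the Davis-Wielandt index of $\mathcal{X}$ is $\eta_{dw}(\mathcal{X})=\inf\{dw(T):T\in S_{\mathcal{L}(\mathcal{X})}\}$. *)

(* Defs.v *)
From HB Require Import structures.
From mathcomp Require Import all_boot all_order all_algebra.
From mathcomp Require Import all_classical all_reals all_analysis.

Set Implicit Arguments.
Unset Strict Implicit.
Unset Printing Implicit Defensive.

Import Order.TTheory GRing.Theory Num.Theory.
Import numFieldNormedType.Exports.

Local Open Scope classical_set_scope.
Local Open Scope ring_scope.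

#[short(type="finDimBanachType")]
HB.structure Definition FinDimBanach (R : numFieldType) :=
  {X of CompleteNormedModule R X & Vector R X}.

Section Geometry.
Variables (R : realType) (X : finDimBanachType R).
Implicit Types (C F A : set X) (x y : X).

Definition unit_ball : set X := [set x | `|x| <= 1].

Definition unit_sphere : set X := [set x | `|x| = 1].

Definition ext C : set X :=
  [set x | C x /\ forall y z (t : R), C y -> C z -> 0 < t -> t < 1 ->
                  x = t *: y + (1 - t) *: z -> y = x /\ z = x].

Definition polyhedral : Prop := finite_set (ext unit_ball).

Definition face C F : Prop :=
  [/\ F `<=` C,
      convex_set (F : set (convex_lmodType X)) &
      forall y z (t : R), C y -> C z -> 0 < t -> t < 1 ->
        F (t *: y + (1 - t) *: z) -> F y /\ F z].

(* The vector space V below is the direction of the affine hull of A, that is,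
   the smallest subspace containing all differences of elements of A. *)
Definition has_affine_dim A (k : nat) : Prop :=
  A !=set0 /\
  exists2 V : {vspace X}, \dim V = k &
    forall U : {vspace X},
      (V <= U)%VS <-> (forall x y, A x -> A y -> x - y \in U).

Definition facet F : Prop :=
  face unit_ball F /\ has_affine_dim F (\dim {:X}).-1.

End Geometry.

Arguments unit_ball {R} X.
Arguments unit_sphere {R} X.
Arguments polyhedral {R} X.

Section Operators.
Variables (R : realType) (X : finDimBanachType R).

(* Meaningful for continuous f; the supremum in R of an unbounded set is 0. *)
Definition opnorm (Y : normedModType R) (f : {linear X -> Y}) : R :=
  sup [set `|f x| | x in unit_ball X].

(* S_{X^*} and S_{L(X)} are the cases Y := R^o and Y := X. *)
Definition op_sphere (Y : normedModType R) : set {linear X -> Y} :=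
  [set f : {linear X -> Y} | continuous f /\ opnorm f = 1].

(* For a linear f, the set v + ker f is {x | f x = f v}. A functional f attains
   its norm at v when |f v| = ||f|| (v is of norm 1 by the last condition), so
   a supporting functional is determined by F only up to sign. *)
Definition supporting_functional (f : {linear X -> R^o}) (F : set X) : Prop :=
  op_sphere f /\
  exists2 v, F v & `|f v| = opnorm f /\
    F = [set v + k | k in [set k | f k = 0]] `&` unit_sphere X.

Definition J (x : X) : set {linear X -> R^o} :=
  [set f : {linear X -> R^o} | f x = 1 /\ op_sphere f].

Definition Pi : set (X * {linear X -> R^o}) :=
  [set p | unit_sphere X p.1 /\ J p.1 p.2].

Definition dw (T : {linear X -> X}) : R :=
  sup [set Num.sqrt (`|p.2 (T p.1)| ^+ 2 + `|T p.1| ^+ 4) | p in Pi].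

Definition eta_dw : R := inf [set dw T | T in @op_sphere X].

(* When X is nonzero, the infimum is a minimum: the function of x is continuous
   and the unit sphere is compact. The default value 0 of the finite maximum is
   irrelevant for n > 0, since square roots are nonnegative. *)
Definition xi (n : nat) (f : 'I_n -> {linear X -> R^o}) : R :=
  inf [set \big[Num.max/0]_(r < n) Num.sqrt (`|f r x| ^+ 2 + 1)
      | x in unit_sphere X].

End Operators.

Arguments op_sphere {R X Y}.
Arguments eta_dw {R} X.

(* Main.v *)
Require Import Defs.
From HB Require Import structures.
From mathcomp Require Import all_boot all_order all_algebra.
From mathcomp Require Import all_classical all_reals all_analysis.
From mathcomp Require Import ring lra.

(** An operator [T] of norm 1 attains its norm at an extreme point of the unit
    ball, that is, at some [v i] up to sign (lemma [opnorm_ext]).  The point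
    [v i] lies on every facet [F i r], and this forces [`|f i r (v i)| = 1]: up
    to the sign of the functional, [(v i, f i r)] belongs to [Pi].  Since
    [`|T (v i)| = 1], evaluating the supremum that defines [dw T] at these
    pairs bounds [dw T] below by the square root of
    [`|f i r (T (v i))| ^+ 2 + 1] for each [r] (lemma [dw_ge_norming]).  As
    [T (v i)] is itself a unit vector, the maximum of these numbers over [r] is
    one of the values whose infimum is [xi (f i)] (lemma [xi_le]).  Hence
    [xi (f i) <= dw T].

    A norm-attaining extreme point is found without decomposing points of the
    ball into extreme points.  Among the maximizers of a continuous convex
    function on the ball, one of largest Euclidean length in coordinates is
    extreme: the ends of a segment of the ball through it are again maximizers,
    hence are not longer, and the strict convexity of the squared Euclidean
    length makes the segment trivial (lemma [convex_max_ext]).  The two maxima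
    exist because the ball is compact in coordinates ([compact_coord_ball]). *)

Import Order.TTheory GRing.Theory Num.Theory.
Import numFieldNormedType.Exports.

Local Open Scope classical_set_scope.
Local Open Scope ring_scope.

Section Helpers.

Set Implicit Arguments.
Unset Strict Implicit.
Import VectorInternalTheory.

Lemma continuous_sumr (K : numFieldType) (T : topologicalType)
    (V : normedModType K) (I : Type) (s : seq I) (h : I -> T -> V) :
  (forall i, continuous (h i)) -> continuous (fun x => \sum_(i <- s) h i x).
Proof.
move=> hc; elim: s => [|i s IHs].
  by under eq_fun do rewrite big_nil; exact: cst_continuous.
under eq_fun do rewrite big_cons.
by move=> x; exact: continuousD (hc i x) (IHs x).
Qed.

(** * The squared Euclidean length of a row vector *)

Section SquaredLength.
Variables (R : realType) (n : nat).
Implicit Types a b e : 'rV[R]_n.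

Definition sqlen a : R := \sum_i a ord0 i ^+ 2.

Lemma sqlen_continuous : continuous sqlen.
Proof.
apply: (@continuous_sumr R _ R^o) => i a.
exact: continuous_comp (@coord_continuous _ _ _ _ _ a) (@exprn_continuous _ 2 _).
Qed.

Lemma sqlen_ge0 a : 0 <= sqlen a.
Proof. by apply: sumr_ge0 => i _; exact: sqr_ge0. Qed.

Lemma sqlen_eq0 a : sqlen a = 0 -> a = 0.
Proof.
move=> /eqP; rewrite psumr_eq0; last by move=> i _; exact: sqr_ge0.
move=> /allP a0; apply/rowP => i; rewrite mxE; apply/eqP.
by rewrite -sqrf_eq0; apply: a0; exact: mem_index_enum.
Qed.

Lemma sqlen_convex_comb a b (t : R) :
  sqlen (t *: a + (1 - t) *: b) =
  t * sqlen a + (1 - t) * sqlen b - t * (1 - t) * sqlen (a - b).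
Proof.
rewrite /sqlen !mulr_sumr -sumrN -!big_split/=; apply: eq_bigr => i _.
by rewrite !mxE; ring.
Qed.

(** Strict convexity, in the form used to recognize extreme points. *)
Lemma sqlen_strictly_convex a b e (t : R) :
  0 < t -> t < 1 -> e = t *: a + (1 - t) *: b ->
  sqlen a <= sqlen e -> sqlen b <= sqlen e -> a = b.
Proof.
move=> t0 t1 -> ; rewrite sqlen_convex_comb => leae lebe.
have t1' : 0 < 1 - t by rewrite subr_gt0.
apply: subr0_eq; apply: sqlen_eq0; apply/eqP.
by rewrite eq_le sqlen_ge0 andbT -(pmulr_rle0 _ (mulr_gt0 t0 t1')); nra.
Qed.

End SquaredLength.

(** * Compactness of the unit ball and maxima of convex functions *)

Section FiniteDimension.
Variables (R : realType) (X : finDimBanachType R).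

Lemma r2v_continuous : continuous (r2v : 'rV[R]_(dim X) -> X).
Proof.
have -> : r2v = fun a : 'rV[R]_(dim X) =>
    \sum_(i < dim X) a ord0 i *: (r2v (delta_mx ord0 i) : X).
  apply/funext => a; rewrite [in LHS](row_sum_delta a) linear_sum.
  by apply: eq_bigr => i _; rewrite linearZ.
by apply: continuous_sumr => i a; apply: continuousZr_tmp; exact: coord_continuous.
Qed.

Lemma norm_r2v_continuous :
  continuous (fun a : 'rV[R]_(dim X) => `|r2v a : X|).
Proof.
move=> a.
by apply: continuous_comp; [exact: r2v_continuous | exact: norm_continuous].
Qed.

(** The nontrivial half of the equivalence of norms: on the compact unit sphere
    of the coordinate space, the norm of [X] has a positive minimum. *)
Lemma coord_norm_bound :
  exists M : R, forall a : 'rV[R]_(dim X), `|a| <= M * `|r2v a : X|.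
Proof.
pose S := [set a : 'rV[R]_(dim X) | `|a| = 1].
have cS : compact S.
  apply: bounded_closed_compact.
    by exists 1; split=> // r r1 a /= ->; exact: ltW.
  by apply: (preimage_closed _ (@closed_eq _ 1)) => a _; exact: norm_continuous.
have S_scale a : a != 0 -> S (`|a|^-1 *: a).
  by move=> a0; rewrite /S /= normrZ normfV normr_id mulVf// normr_eq0.
have [S0|/set0P Sn0] := eqVneq S set0.
  (* The sphere is empty only when the dimension is 0. *)
  exists 0 => a; have [->|/S_scale] := eqVneq a 0; first by rewrite normr0 mul0r.
  by rewrite S0.
have [b /set_mem bS bmin] :=
  compact_EVT_min Sn0 cS (continuous_subspaceT norm_r2v_continuous).
have b_gt0 : 0 < `|r2v b : X|.
  rewrite normr_gt0; apply: contra_eq_neq (_ : `|b| = 1) => //.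
  move=> /(congr1 v2r); rewrite r2vK linear0 => ->.
  by rewrite normr0 eq_sym oner_neq0.
exists `|r2v b : X|^-1 => a; have [->|a0] := eqVneq a 0.
  by rewrite !linear0 !normr0 mulr0.
rewrite ler_pdivlMl// -ler_pdivlMr ?normr_gt0//.
have := bmin _ (mem_set (S_scale _ a0)).
by rewrite linearZ normrZ normfV normr_id mulrC.
Qed.

Lemma compact_coord_ball :
  compact [set a : 'rV[R]_(dim X) | unit_ball X (r2v a)].
Proof.
have [M aM] := coord_norm_bound.
apply: bounded_closed_compact.
  exists `|M|; split=> // r /ltW Mr a /= a1.
  apply: le_trans (aM a) _; apply: le_trans (ler_norm _) _.
  by rewrite normrM normr_id -[leRHS]mulr1 ler_pM.
by apply: (preimage_closed _ (@closed_le _ 1)) => a _; exact: norm_r2v_continuous.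
Qed.

(** Bauer's maximum principle for the unit ball.  The coordinates [e] of the
    extreme point maximize [sqlen] on the compact set [K] of the coordinates
    of all maximizers of [phi]. *)
Lemma convex_max_ext (phi : X -> R) : continuous phi ->
  (forall x y (t : R), 0 < t -> t < 1 ->
     phi (t *: x + (1 - t) *: y) <= t * phi x + (1 - t) * phi y) ->
  exists2 e, ext (unit_ball X) e & forall x, unit_ball X x -> phi x <= phi e.
Proof.
move=> phic phi_cvx.
pose B := [set a : 'rV[R]_(dim X) | unit_ball X (r2v a)].
have phirc : continuous (fun a : 'rV[R]_(dim X) => phi (r2v a)).
  by move=> a; apply: continuous_comp; [exact: r2v_continuous | exact: phic].
have B0 : B !=set0 by exists 0; rewrite /B /unit_ball /= linear0 normr0.
have [c /set_mem Bc cmax] :=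
  compact_EVT_max B0 compact_coord_ball (continuous_subspaceT phirc).
pose K := B `&` [set a | phi (r2v a) = phi (r2v c)].
have K0 : K !=set0 by exists c.
have cK : compact K.
  apply: compact_closedI compact_coord_ball _.
  by apply: (preimage_closed _ (@closed_eq _ _)) => a _; exact: phirc.
have [e /set_mem [Be phie] emax] :=
  compact_EVT_max K0 cK (continuous_subspaceT (@sqlen_continuous _ _)).
have phimax x : unit_ball X x -> phi x <= phi (r2v c).
  by move=> xB; have := cmax (v2r x); rewrite v2rK; apply; rewrite inE /B/= v2rK.
exists (r2v e); last by move=> x /phimax; rewrite phie.
split=> // y z t yB zB t0 t1 eyz.
have := phi_cvx y z t t0 t1; rewrite -eyz phie => le_phi.
have y_max := phimax _ yB; have z_max := phimax _ zB.
have t1' : 0 < 1 - t by rewrite subr_gt0.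
have phiy : phi y = phi (r2v c) by nra.
have phiz : phi z = phi (r2v c) by nra.
have qy : sqlen (v2r y) <= sqlen e by apply: emax; rewrite inE /K /B /= v2rK.
have qz : sqlen (v2r z) <= sqlen e by apply: emax; rewrite inE /K /B /= v2rK.
have e_eq : e = t *: v2r y + (1 - t) *: v2r z.
  by apply: (can_inj (@r2vK _ X)); rewrite eyz linearD !linearZ /= !v2rK.
have /(can_inj (@v2rK _ X)) yz := sqlen_strictly_convex t0 t1 e_eq qy qz.
by rewrite eyz yz -scalerDl subrKC scale1r.
Qed.

End FiniteDimension.

(** * Operator norms *)

Section OperatorNorm.
Variables (R : realType) (X : finDimBanachType R) (Y : normedModType R).
Implicit Types g : {linear X -> Y}.

Lemma opnorm_ext g : continuous g ->
  exists2 e, ext (unit_ball X) e &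
    `|g e| = opnorm g /\ forall x, unit_ball X x -> `|g x| <= opnorm g.
Proof.
move=> gc.
have [||e exte emax] := @convex_max_ext R X (fun x => `|g x|).
- by move=> x; apply: continuous_comp; [exact: gc | exact: norm_continuous].
- move=> x y t t0 t1; rewrite linearD !linearZ.
  by apply: le_trans (ler_normD _ _) _; rewrite !normrZ !gtr0_norm ?subr_gt0.
have ub : ubound [set `|g x| | x in unit_ball X] `|g e|.
  by move=> _ [x xB <-]; exact: emax.
have -> : opnorm g = `|g e|.
  apply/eqP; rewrite eq_le; apply/andP; split.
    by apply: ge_sup => //; exists `|g e|, e => //; case: exte.
  by apply: ub_le_sup; [exists `|g e| | exists e => //; case: exte].
by exists e.
Qed.

Lemma op_sphere_le1 g x : op_sphere g -> `|x| <= 1 -> `|g x| <= 1.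
Proof. by move=> [/opnorm_ext[e _ [_ gle]] g1] x1; rewrite -g1; exact: gle. Qed.

Lemma opnormN g : opnorm (\- g) = opnorm g.
Proof. by congr (sup _); apply: eq_imagel => x _ /=; rewrite normrN. Qed.

End OperatorNorm.

(** Guards against the junk value of [eta_dw], the infimum of the empty set. *)
Lemma id_op_sphere (R : realType) (X : finDimBanachType R) (x : X) :
  x != 0 -> @op_sphere R X X idfun.
Proof.
move=> x0; split; first by move=> y; exact: cvg_id.
apply/eqP; rewrite eq_le; apply/andP; split.
  apply: ge_sup; last by move=> _ [y yB <-].
  by exists `|0 : X|, 0 => //=; rewrite /unit_ball /= normr0.
apply: ub_le_sup; first by exists 1 => _ [y yB <-].
by exists (`|x|^-1 *: x); rewrite /unit_ball /= normrZ normfV normr_id mulVf//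
  normr_eq0.
Qed.

(** * Lower bounds for the Davis-Wielandt radius *)

Section DavisWielandt.
Variables (R : realType) (X : finDimBanachType R).

(** The supremum [dw T] is not the default value of an unbounded set: both
    [`|T x|] and [`|f (T x)|] are at most 1 on [Pi]. *)
Lemma dw_ge (T : {linear X -> X}) (x : X) (f : {linear X -> R^o}) :
  op_sphere T -> Pi (x, f) ->
  Num.sqrt (`|f (T x)| ^+ 2 + `|T x| ^+ 4) <= dw T.
Proof.
move=> Ts xf; apply: ub_le_sup; last by exists (x, f).
exists (Num.sqrt (1 + 1)) => _ [[y g] [/= y1 [_ gs]] <-].
have Ty : `|T y| <= 1 by apply: op_sphere_le1 => //; rewrite y1.
by apply: ler_wsqrtr; rewrite lerD// exprn_ile1//; exact: op_sphere_le1.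
Qed.

(** [f] is constant on the facet, where one of its values is [opnorm f] up to
    sign. *)
Lemma supporting_functional_norming (f : {linear X -> R^o}) (F : set X) (x : X) :
  supporting_functional f F -> F x -> [/\ op_sphere f, `|x| = 1 & `|f x| = 1].
Proof.
move=> [fs [w _ [fw ->]]] [[k /= fk <-] x1]; split=> //.
by rewrite linearD fk addr0 fw; case: fs.
Qed.

Lemma dw_ge_norming (T : {linear X -> X}) (x : X) (f : {linear X -> R^o}) :
  op_sphere T -> op_sphere f -> `|x| = 1 -> `|f x| = 1 -> `|T x| = 1 ->
  Num.sqrt (`|f (T x)| ^+ 2 + 1) <= dw T.
Proof.
move=> Ts fs x1 fx Tx.
(* [J x] contains [f] or [- f], according to the sign of [f x]. *)
have [g gs [gx gT]] : exists2 g : {linear X -> R^o}, op_sphere g &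
    g x = 1 /\ `|g (T x)| = `|f (T x)|.
  have [fx0|fx0] := leP 0 (f x : R).
    by exists f => //; split=> //; rewrite -fx ger0_norm.
  exists (\- f) => /=; last by rewrite normrN -fx ltr0_norm.
  case: fs => fc f1; split; last by rewrite opnormN.
  by move=> y; apply: continuousN; exact: fc.
by have := @dw_ge T x g Ts; rewrite gT Tx expr1n; apply; split.
Qed.

Lemma xi_le (n : nat) (f : 'I_n -> {linear X -> R^o}) (x : X) (M : R) :
  (0 < n)%N -> `|x| = 1 -> (forall r, Num.sqrt (`|f r x| ^+ 2 + 1) <= M) ->
  xi f <= M.
Proof.
move=> n0 x1 fM.
have M0 : 0 <= M by apply: le_trans (fM (Ordinal n0)).
apply: (@le_trans _ _ (\big[Num.max/0]_(r < n) Num.sqrt (`|f r x| ^+ 2 + 1))).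
  apply: ge_inf; last by exists x.
  by exists 0 => _ [y _ <-]; exact: bigmax_ge_id.
by apply: bigmax_le.
Qed.

End DavisWielandt.

End Helpers.

Theorem theorem3p10 (R : realType) (X : finDimBanachType R) (n m : nat)
    (n_gt0 : (0 < n)%N) (m_gt0 : (0 < m)%N)
    (dimX : \dim {:X} = n) (polyX : polyhedral X)
    (v : 'I_m -> X)
    (extB : ext (unit_ball X) = [set x | exists i, x = v i \/ x = - v i])
    (F : 'I_m -> 'I_n -> set X)
    (F_facet : forall i r, facet (F i r))
    (F_distinct : forall i, injective (F i))
    (F_meet : forall i r, F i r (v i))
    (f : 'I_m -> 'I_n -> {linear X -> R^o})
    (f_supp : forall i r, supporting_functional (f i r) (F i r)) :
  eta_dw X >= \big[Num.min/xi (f (Ordinal m_gt0))]_(i < m) xi (f i).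
Proof.
apply: lb_le_inf.
  pose i0 := Ordinal m_gt0.
  have [_ vi1 _] :=
    supporting_functional_norming (f_supp i0 (Ordinal n_gt0)) (F_meet _ _).
  exists (dw (idfun : {linear X -> X})), idfun => //.
  by apply: (@id_op_sphere _ _ (v i0)); rewrite -normr_eq0 vi1 oner_neq0.
move=> _ [T Ts <-]; have [Tc T1] := Ts.
have [e exte [Te _]] := opnorm_ext Tc.
have [i ei] : exists i, e = v i \/ e = - v i by move: exte; rewrite extB.
have Tvi : `|T (v i)| = 1.
  by rewrite -T1 -Te; case: ei => ->; rewrite ?linearN ?normrN.
apply: (@le_trans _ _ (xi (f i))); first exact: bigmin_le.
apply: (xi_le n_gt0 Tvi) => r.
have [fs vi1 fvi1] := supporting_functional_norming (f_supp i r) (F_meet i r).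
exact: dw_ge_norming.
Qed.
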